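(* For any $t>0$, there exist one-dimensional, unimodal probability distributions $\hat\pi$ and $\pi$ with $D_2(\pi\mid\hat\pi)<0.4$ such that $\sigma_{\hat\pi}^2\ge t\,\sigma_\pi^2$ and $(m_{\hat\pi}-m_\pi)^2\ge t\,\sigma_\pi^2$.
   Context: For a probability distribution $\xi$ on $\mathbb{R}$, $m_\xi$ denotes its mean and $\sigma_\xi^2$ its variance. For $\pi\ll\xi$, $D_2(\pi\mid\xi)=\log\int\frac{d\pi}{d\xi}\,d\pi$ is the Rényi divergence of order $2$. *)

(* Defs.v *)
From HB Require Import structures.
From mathcomp Require Import all_boot all_order all_algebra.
From mathcomp Require Import all_classical all_reals all_analysis.

Set Implicit Arguments.
Unset Strict Implicit.
Unset Printing Implicit Defensive.

Import Order.TTheory GRing.Theory Num.Theory.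

Local Open Scope classical_set_scope.
Local Open Scope ring_scope.
Local Open Scope ereal_scope.
Local Open Scope charge_scope.

Notation realDistribution R := (probability (measurableTypeR R) R).

Definition has_density (R : realType) (P : realDistribution R) (f : R -> R) :
    Prop :=
  [/\ measurable_fun [set: R] f,
      (forall x, 0 <= f x)%R &
      forall A : set R, measurable A ->
        P A = \int[lebesgue_measure]_(x in A) (f x)%:E].

(* Unimodality is meant in the sense of Lebesgue densities; distributions with
   an atom at the mode, such as Dirac masses, are thereby excluded. *)
Definition unimodal (R : realType) (P : realDistribution R) : Prop :=
  exists f : R -> R, has_density P f /\
  exists m : R,
    (forall x y, x <= y -> y <= m -> f x <= f y)%R /\
    (forall x y, m <= x -> x <= y -> f y <= f x)%R.

Definition finite_second_moment (R : realType) (P : realDistribution R) :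
    Prop :=
  (fun x : R => x) \in Lfun P 2%:E.

Definition mean (R : realType) (P : realDistribution R) : \bar R :=
  'E_P[fun x : R => x].

Definition var (R : realType) (P : realDistribution R) : \bar R :=
  'V_P[fun x : R => x].

(* The library's Radon-Nikodym derivative is the constant -oo when
   [P `<< Q] fails, so this value is only meaningful under [P `<< Q]. *)
Definition renyi2 (R : realType) (P Q : realDistribution R) : \bar R :=
  lne (\int[P]_x ('d (charge_of_finite_measure P) '/d Q) x).

(* Main.v *)
Require Import Defs.
From HB Require Import structures.
From mathcomp Require Import all_boot all_order all_algebra.
From mathcomp Require Import all_classical all_reals all_analysis.
From mathcomp Require Import measurable_realfun.
From mathcomp Require Import ring lra.

Set Implicit Arguments.
Unset Strict Implicit.
Unset Printing Implicit Defensive.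

Import Order.TTheory GRing.Theory Num.Theory.
Import numFieldNormedType.Exports.

Local Open Scope ring_scope.
Local Open Scope ereal_scope.

(** pi is the uniform law on [0, 1], and hpi = 3/4 pi + 1/4 U[0, L]. Since
    hpi >= 3/4 pi, the density of pi with respect to hpi is at most 4/3, whatever
    L is, so the divergence is at most ln (4/3) < 0.4; but both the variance of
    hpi and the squared gap between the means grow like L^2. *)

(** * Mixtures of two probability measures *)

Section mixture.
Context d (T : measurableType d) (R : realType).
Variables (p q : {nonneg R}) (pq1 : (p%:num + q%:num = 1)%R).
Variables P Q : probability T R.

(** The equation on the weights is carried as an argument so that the probability structure declared
    below can be inferred from the term. *)
Definition mixture (_ : (p%:num + q%:num = 1)%R) : set T -> \bar R :=
  measure_add (mscale p P) (mscale q Q).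

Lemma mixtureE A : mixture pq1 A = p%:num%:E * P A + q%:num%:E * Q A.
Proof. by rewrite /mixture measure_addE. Qed.

HB.instance Definition _ := Measure.on (mixture pq1).

Let mixture_setT : mixture pq1 [set: T] = 1.
Proof.
by rewrite mixtureE (probability_setT P) (probability_setT Q) !mule1 -EFinD pq1.
Qed.

HB.instance Definition _ :=
  Measure_isProbability.Build _ _ R (mixture pq1) mixture_setT.

Lemma ge0_integral_mixture (f : T -> \bar R) :
    measurable_fun [set: T] f -> (forall x, 0 <= f x) ->
  \int[mixture pq1]_x f x =
  p%:num%:E * \int[P]_x f x + q%:num%:E * \int[Q]_x f x.
Proof.
by move=> mf f0; rewrite ge0_integral_measure_add// !ge0_integral_mscale.
Qed.

Lemma mixture_dominates : (0 < p%:num)%R -> P `<< mixture pq1.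
Proof.
move=> p0; apply/null_content_dominatesP => A mA.
move=> M0; have /eqP := mixtureE A; rewrite {}M0 eq_sym padde_eq0 ?mule_ge0//.
by move=> /andP[+ _]; rewrite mule_eq0 eqe gt_eqF//= => /eqP.
Qed.

End mixture.

(** * The Radon-Nikodym derivative and the bound on the divergence *)

Section radon_nikodym.
Context d (T : measurableType d) (R : realType).
Variables P Q : probability T R.
Hypothesis PQ : P `<< Q.
Local Open Scope charge_scope.
Local Notation g := ('d (charge_of_finite_measure P) '/d Q).

(* The library does not choose the derivative nonnegative everywhere, hence the
   absolute value. *)
Lemma integral_abs_Radon_Nikodym : \int[Q]_x `|g x| = 1.
Proof.
(* This version of the derivative is nonnegative everywhere and integrates to [P setT]; [g] equals
   it [Q]-almost everywhere, hence so does its absolute value. *)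
have f0 := Radon_Nikodym_SigmaFinite.f_ge0 PQ.
have fi := Radon_Nikodym_SigmaFinite.f_integrable PQ.
rewrite -(probability_setT P) (Radon_Nikodym_SigmaFinite.f_integral PQ)//.
apply: ge0_ae_eq_integral => //.
- by apply: measurableT_comp => //; apply: measurable_int;
    exact: Radon_Nikodym_integrable.
- exact: measurable_int fi.
- have := ae_eq_Radon_Nikodym_SigmaFinite PQ measurableT.
  by apply: filterS => x /= fg /fg <-; rewrite gee0_abs.
Qed.

End radon_nikodym.

(** Let [g] be the derivative of [P] with respect to the mixture. Integrating [|g|] against the
    mixture gives [1], and the share coming from [P] is [p] times its integral under [P]; so the
    integral of [g] under [P] is at most [1/p]. Then [ln (1/p) <= 1/p - 1]. *)
Lemma renyi2_mixture (R : realType) (p q : {nonneg R})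
    (pq1 : (p%:num + q%:num = 1)%R) (P Q : realDistribution R) :
    (0 < p%:num)%R ->
  renyi2 P (mixture P Q pq1) <= (p%:num^-1 - 1)%:E.
Proof.
move=> p0; have PM : P `<< mixture P Q pq1 := mixture_dominates p0.
have mg : measurable_fun setT
    (Radon_Nikodym (charge_of_finite_measure P) (mixture P Q pq1)).
  by apply: measurable_int; exact: Radon_Nikodym_integrable.
rewrite /renyi2; set I := integral _ _ _.
have Ip : I <= (p%:num^-1)%:E.
  rewrite (le_trans (lee_abs _))// (le_trans (le_abse_integral _ _ _))//.
  rewrite -(mule1 (_^-1)%:E) lee_pdivlMl//.
  rewrite -(integral_abs_Radon_Nikodym PM) ge0_integral_mixture//; last first.
    exact: measurableT_comp.
  by rewrite leeDl// mule_ge0// integral_ge0.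
(* [lne] sends nonpositive arguments to [-oo]; for [0 < I] the bound is [ln (1 + x) <= x] at
   [x = 1/p - 1]. *)
have [I0|I0] := leP I 0; first by rewrite le0_lneNy// leNye.
rewrite (@le_trans _ _ (lne (1 + (p%:num^-1 - 1)%:E)))//.
  rewrite lee_lne ?in_itv/= ?leey ?andbT ?(ltW I0)//; last first.
    by rewrite -EFinD lee_fin subrKC invr_ge0.
  by rewrite -EFinD subrKC.
by rewrite le_lne1Dx// lee_fin lerBrDr addNr invr_ge0.
Qed.

(** * Moments of laws carried by the nonnegative half-line *)

Section moments.
Context {R : realType}.
Implicit Type P : realDistribution R.

(** Moments are computed with [|x| ^+ n], whose nonnegativity lets the integral split over a
    mixture. *)
Lemma measurable_abs_moment n :
  measurable_fun [set: measurableTypeR R] (fun x : R => (`|x| ^+ n)%:E).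
Proof. exact/measurable_EFinP/measurable_funX. Qed.

Lemma finite_second_moment_lty P :
  \int[P]_x (`|x| ^+ 2)%:E < +oo -> finite_second_moment P.
Proof.
move=> P2; rewrite /finite_second_moment inE; apply/andP; split.
  by rewrite inE/=; exact: measurable_id.
rewrite inE/= /finite_norm unlock/=.
apply: poweR_lty; apply: le_lt_trans P2.
by under eq_integral do rewrite powR_mulrn//.
Qed.

(** [x] and [|x|] differ only on the negative half-line, which is a null set. *)
Lemma mean_ge0_supp P : P `]-oo, 0%R[%classic = 0 ->
  mean P = \int[P]_x (`|x| ^+ 1)%:E.
Proof.
move=> P0; rewrite /mean unlock; apply: ae_eq_integral => //.
- exact: measurable_abs_moment.
- exists `]-oo, 0%R[%classic; split => //.
  move=> x /= H; rewrite in_itv/= ltNge; apply/negP => x0; apply: H => _.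
  by rewrite expr1 ger0_norm.
Qed.

Lemma var_ge0_supp P (m1 m2 : R) : P `]-oo, 0%R[%classic = 0 ->
    \int[P]_x (`|x| ^+ 1)%:E = m1%:E -> \int[P]_x (`|x| ^+ 2)%:E = m2%:E ->
  var P = (m2 - m1 ^+ 2)%:E.
Proof.
move=> P0 P1 P2; rewrite /var varianceE; last first.
  by apply: finite_second_moment_lty; rewrite P2 ltry.
have := mean_ge0_supp P0; rewrite /mean P1 => ->.
rewrite EFinB -P2 -EFin_expe; congr (_ - _).
rewrite unlock; apply: eq_integral => x _.
by rewrite real_normK ?num_real.
Qed.

Lemma integral_itv_exprn (b : R) n : (0 < b)%R ->
  \int[lebesgue_measure]_(x in `[0%R, b]%classic) (x ^+ n)%:E =
  (b ^+ n.+1 / n.+1%:R)%:E.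
Proof.
move=> b0.
have dX (x : R) : derivable (fun y : R => y ^+ n.+1)%R x 1.
  exact: exprn_derivable.
have cX (x : R) : continuous_at x (fun y : R => y ^+ n.+1 / n.+1%:R)%R.
  by apply: cvgMl; exact: exprn_continuous.
rewrite (@continuous_FTC2 _ _ (fun x => x ^+ n.+1 / n.+1%:R)%R)//.
- by rewrite expr0n/= mul0r sube0.
- by apply: continuous_in_subspaceT => x _; exact: exprn_continuous.
- split.
  + by move=> x _; exact: derivableM.
  + by apply: cvg_at_right_filter; exact: cX.
  + by apply: cvg_at_left_filter; exact: cX.
- move=> x _; rewrite derive1Mr// derive1E exp_derive.
  by rewrite -mulr_natl scaler1 mulrAC divff ?pnatr_eq0// mul1r.
Qed.

End moments.

(** * The uniform law on [[0, b]] *)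

Section uniform.
Context {R : realType} (b : R) (b0 : (0 < b)%R).

Lemma uniform_has_density :
  has_density (uniform_prob b0 : realDistribution R) (uniform_pdf 0 b).
Proof.
split => //; first exact: measurable_uniform_pdf.
by move=> x; exact: uniform_pdf_ge0.
Qed.

Lemma uniform_pdf_nondecreasing (x y : R) : (x <= y)%R -> (y <= 0)%R ->
  (uniform_pdf 0 b x <= uniform_pdf 0 b y)%R.
Proof.
(* The density jumps at [0], so [x = y] is set apart; otherwise [x < 0], where the density
   vanishes. *)
move=> xy y0; have [->//|neq] := eqVneq x y.
have x0 : (x < 0)%R by rewrite (lt_le_trans _ y0)// lt_neqAle neq.
by rewrite [leLHS]/uniform_pdf (lt_geF x0) uniform_pdf_ge0.
Qed.

Lemma uniform_pdf_nonincreasing (x y : R) : (0 <= x)%R -> (x <= y)%R ->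
  (uniform_pdf 0 b y <= uniform_pdf 0 b x)%R.
Proof.
move=> x0 xy; rewrite /uniform_pdf x0 (le_trans x0 xy)/=.
have [yb|_] := leP y b; first by rewrite (le_trans xy yb).
by case: ifP => // _; rewrite subr0 invr_ge0 ltW.
Qed.

Lemma unimodal_uniform : unimodal (uniform_prob b0 : realDistribution R).
Proof.
exists (uniform_pdf 0 b); split; first exact: uniform_has_density.
(* Every point of [[0, b]] is a mode; [0] is the choice common to all [b]. *)
exists 0%R; split; first exact: uniform_pdf_nondecreasing.
exact: uniform_pdf_nonincreasing.
Qed.

Lemma uniform_ge0_supp : uniform_prob b0 `]-oo, 0%R[%classic = 0.
Proof.
rewrite /uniform_prob integral0_eq// => x; rewrite /= in_itv/= => x0.
by rewrite /uniform_pdf (lt_geF x0).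
Qed.

Lemma uniform_abs_moment n :
  \int[uniform_prob b0]_x (`|x| ^+ n)%:E = (b ^+ n / n.+1%:R)%:E.
Proof.
rewrite integral_uniform//; last exact: measurable_abs_moment.
under eq_integral => x.
  rewrite inE/= in_itv/= => /andP[x0 _]; rewrite ger0_norm//.
  over.
rewrite integral_itv_exprn// -EFinM subr0 exprS -mulrA mulKf//.
by rewrite gt_eqF.
Qed.

End uniform.

(** * Density, mode and moments of a mixture of uniform laws *)

Lemma has_density_mixture (R : realType) (p q : {nonneg R})
    (pq1 : (p%:num + q%:num = 1)%R) (P Q : realDistribution R) (f g : R -> R) :
    has_density P f -> has_density Q g ->
  has_density (mixture P Q pq1) (fun x => p%:num * f x + q%:num * g x)%R.
Proof.
move=> [mf f0 Pf] [mg g0 Qg]; split.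
- by apply: measurable_funD; exact: measurable_funM.
- by move=> x; rewrite addr_ge0// mulr_ge0.
- move=> A mA; rewrite /= mixtureE Pf// Qg//.
  under [RHS]eq_integral do rewrite EFinD !EFinM.
  rewrite ge0_integralD//.
  + rewrite !ge0_integralZl//.
    * by apply/measurable_EFinP; exact: measurable_funTS.
    * by move=> x _; rewrite lee_fin.
    * by apply/measurable_EFinP; exact: measurable_funTS.
    * by move=> x _; rewrite lee_fin.
  + by move=> x _; rewrite mule_ge0// lee_fin.
  + by apply/measurable_EFinP/measurable_funM => //; exact: measurable_funTS.
  + by move=> x _; rewrite mule_ge0// lee_fin.
  + by apply/measurable_EFinP/measurable_funM => //; exact: measurable_funTS.
Qed.

Section uniform_mixture.
Context {R : realType} (p q : {nonneg R}) (pq1 : (p%:num + q%:num = 1)%R).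
Variables (a b : R) (a0 : (0 < a)%R) (b0 : (0 < b)%R).
Local Notation M :=
  (mixture (uniform_prob a0) (uniform_prob b0) pq1 : realDistribution R).

(** Mixing can destroy unimodality, but here both densities have the mode [0], and nonnegative
    combinations preserve monotonicity on each side of it. *)
Lemma unimodal_uniform_mixture : unimodal M.
Proof.
exists (fun x => p%:num * uniform_pdf 0 a x + q%:num * uniform_pdf 0 b x)%R.
split; first by apply: has_density_mixture; exact: uniform_has_density.
exists 0%R; split => x y xy yz; rewrite lerD// ler_wpM2l//.
- exact: uniform_pdf_nondecreasing.
- exact: uniform_pdf_nondecreasing.
- exact: uniform_pdf_nonincreasing.
- exact: uniform_pdf_nonincreasing.
Qed.

Lemma uniform_mixture_ge0_supp : M `]-oo, 0%R[%classic = 0.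
Proof.
by rewrite /= mixtureE /= !uniform_ge0_supp !mule0 adde0.
Qed.

Lemma uniform_mixture_abs_moment n : \int[M]_x (`|x| ^+ n)%:E =
  (p%:num * (a ^+ n / n.+1%:R) + q%:num * (b ^+ n / n.+1%:R))%:E.
Proof.
rewrite ge0_integral_mixture//; last exact: measurable_abs_moment.
by rewrite !uniform_abs_moment.
Qed.

End uniform_mixture.

Theorem proposition3p3 (R : realType) (t : R) (ht : (0 < t)%R) :
  exists hpi pi : realDistribution R,
    [/\ unimodal hpi, unimodal pi,
        finite_second_moment hpi & finite_second_moment pi] /\
    [/\ pi `<< hpi,
        renyi2 pi hpi < (4 / 10)%:E,
        t%:E * var pi <= var hpi &
        t%:E * var pi <= (mean hpi - mean pi) ^+ 2].
Proof.
(* The length is [L = t + 4]. A length of order [sqrt t] would suffice, but this choice keeps the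
   final inequalities polynomial in [t]. *)
have L0 : (0 < t + 4)%R by rewrite addr_gt0.
have pq1 : ((3 / 4)%:nng%:num + (1 / 4)%:nng%:num = 1 :> R)%R by rewrite /=; lra.
have p0 : (0 < (3 / 4)%:nng%:num :> R)%R by rewrite /=; lra.
pose U1 : realDistribution R := uniform_prob (@ltr01 R).
pose UL : realDistribution R := uniform_prob L0.
pose M : realDistribution R := mixture U1 UL pq1.
have U1_0 : U1 `]-oo, 0%R[%classic = 0 := uniform_ge0_supp _.
have M_0 : M `]-oo, 0%R[%classic = 0 := uniform_mixture_ge0_supp _ _ _.
have U1m := uniform_abs_moment (@ltr01 R).
have Mm := uniform_mixture_abs_moment pq1 (@ltr01 R) L0.
exists M, U1; split; split.
- exact: unimodal_uniform_mixture.
- exact: unimodal_uniform.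
- by apply: finite_second_moment_lty; rewrite Mm ltry.
- by apply: finite_second_moment_lty; rewrite U1m ltry.
- exact: mixture_dominates.
(* With [p = 3/4] the bound [1/p - 1] is [1/3]. *)
- by rewrite (le_lt_trans (renyi2_mixture _ _ _ p0))// lte_fin/=; lra.
(* The claim becomes [t / 12 <= (13 L^2 - 18 L + 21) / 192]. *)
- rewrite (var_ge0_supp U1_0 (U1m 1%N) (U1m 2%N)) (var_ge0_supp M_0 (Mm 1%N) (Mm 2%N)).
  by rewrite -EFinM lee_fin/=; nra.
(* The means differ by [(L - 1) / 8], so the claim becomes [t / 12 <= (t + 3)^2 / 64]. *)
- rewrite (var_ge0_supp U1_0 (U1m 1%N) (U1m 2%N)).
  rewrite (mean_ge0_supp U1_0) (mean_ge0_supp M_0) U1m Mm.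
  by rewrite -EFinB -EFin_expe -EFinM lee_fin/=; nra.
Qed.
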